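(* Let $\alpha_i,\beta_i,\gamma_i$ ($1\le i\le n-1$) be complex numbers. For any $t_1,t_2,\dots,t_{n-1}$, let $\tilde M_Q(t_1,\dots,t_{n-1})$ be the $n\times n$ unit upper triangular matrix with $(j,j+1)$ entry $t_j$ for $j=1,\dots,n-1$ and with $(j+1,k+1)$ entry $$a_{jk}=-\beta_{j+1}\,\alpha^{\times}_{j+1,k}\,\gamma_k,\qquad \alpha^{\times}_{j+1,k}=\alpha_{j+2}\alpha_{j+3}\cdots\alpha_{k-1},$$ for $0\le j$, $j+2\le k\le n-1$. Then $\tilde M_Q(t_1,\dots,t_{n-1})$ is upper triangular $2$-quasiseparable with generators $$d_j=1\ (j=1,\dots,n),\qquad g_j=[\,t_j\;\;-\beta_j\,]\ (j=1,\dots,n-1),$$ $$b_i=\begin{bmatrix}0&0\\ \gamma_i&\alpha_i\end{bmatrix}\ (i=2,\dots,n-1),\qquad h_k=[\,1\;\;0\,]^T\ (k=2,\dots,n).$$ That is, $$[\tilde M_Q(t_1,\dots,t_{n-1})]_{jk}=\begin{cases}0,&k<j,\\ d_j,&k=j,\\ g_jh_k,&k=j+1,\\ g_jb_{j+1}b_{j+2}\cdots b_{k-1}h_k,&k>j+1.\end{cases}$$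
   Context: Empty products equal $1$. An $n\times n$ matrix is called upper triangular $2$-quasiseparable with generators $d_j\in\mathbb{C}$, $g_j\in\mathbb{C}^{1\times2}$, $b_i\in\mathbb{C}^{2\times2}$, $h_k\in\mathbb{C}^{2\times1}$ if its entries are given by the displayed case formula. *)

(* Defs.v *)
From HB Require Import structures.
From mathcomp Require Import all_boot all_order all_algebra.

Set Implicit Arguments.
Unset Strict Implicit.
Unset Printing Implicit Defensive.

Import GRing.Theory.
Local Open Scope ring_scope.

(* Scalars and generators are families indexed by nat and numbered from 1, of  *)
(* which only the values in the relevant index range are ever used. Rows and   *)
(* columns of 'M_n are numbered from 0, so that A j k (j k : 'I_n) is the      *)
(* entry of A in position (j + 1, k + 1) in the usual 1-based numbering.       *)

(* The product of the b i is the matrix product, in increasing order of i.     *)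
Definition upper_2quasiseparable (C : comNzRingType) (n : nat) (A : 'M[C]_n)
    (d : nat -> C) (g : nat -> 'rV[C]_2) (b : nat -> 'M[C]_2)
    (h : nat -> 'cV[C]_2) : Prop :=
  forall j k : 'I_n,
    A j k =
      if (k < j)%N then 0
      else if k == j then d j.+1
      else if (k == j.+1 :> nat) then (g j.+1 *m h k.+1) 0 0
      else (g j.+1 *m (\prod_(j.+2 <= i < k.+1) b i) *m h k.+1) 0 0.

Definition alpha_times (C : comNzRingType) (alpha : nat -> C) (i k : nat) : C :=
  \prod_(i.+1 <= l < k) alpha l.

Definition MQ_entry (C : comNzRingType) (alpha beta gamma : nat -> C)
    (j k : nat) : C :=
  - beta j.+1 * alpha_times alpha j.+1 k * gamma k.

Definition MQ_tilde (C : comNzRingType) (n : nat)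
    (alpha beta gamma t : nat -> C) : 'M[C]_n :=
  \matrix_(j < n, k < n)
    if (k < j)%N then 0
    else if k == j then 1
    else if (k == j.+1 :> nat) then t j.+1
    else MQ_entry alpha beta gamma j k.

Definition MQ_gen_d (C : comNzRingType) (j : nat) : C := 1.

Definition MQ_gen_g (C : comNzRingType) (beta t : nat -> C) (j : nat) :
    'rV[C]_2 :=
  \row_(q < 2) [:: t j; - beta j]`_q.

Definition MQ_gen_b (C : comNzRingType) (alpha gamma : nat -> C) (i : nat) :
    'M[C]_2 :=
  \matrix_(p < 2, q < 2)
    (nth [::] [:: [:: 0; 0];
                  [:: gamma i; alpha i]] p)`_q.

Definition MQ_gen_h (C : comNzRingType) (k : nat) : 'cV[C]_2 :=
  \col_(p < 2) [:: 1; 0]`_p.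

(* Main.v *)
Require Import Defs.
From HB Require Import structures.
From mathcomp Require Import all_boot all_order all_algebra.
From mathcomp Require Import reals complex.

Set Implicit Arguments.
Unset Strict Implicit.
Unset Printing Implicit Defensive.

Import GRing.Theory.
Local Open Scope ring_scope.

(** Let e1 = [1 0]^T (the common value of the h k) and e2 = [0 1]^T. The line
    spanned by e2 is invariant under every b i, which acts on it as the scalar
    alpha i, and b i sends e1 into that line, namely to gamma i times e2. So in
    the product g_j b_(j+1) ... b_(k-1) e1, read from right to left, the last
    factor b contributes its gamma and moves e1 onto the line, every other
    factor b contributes its alpha (lemma [mul_prod_MQ_gen_b_h]), and g_j reads
    off the coefficient - beta_j. When there is no factor b at all, e1 has not
    moved, and g_j reads off t_j instead. *)

Section Generators.

Variables (C : comNzRingType) (alpha beta gamma t : nat -> C).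

Let b := MQ_gen_b alpha gamma.
Let h := @MQ_gen_h C.
Let e2 : 'cV[C]_2 := delta_mx 1 0.

Lemma mul_MQ_gen_b_e2 i : b i *m e2 = alpha i *: e2.
Proof.
apply/colP; case=> -[|[|//]] ? /=; rewrite !mxE big_ord_recr big_ord1 !mxE /=.
  by rewrite !mul0r mulr0 addr0.
by rewrite mulr0 add0r.
Qed.

Lemma mul_MQ_gen_b_h i k : b i *m h k = gamma i *: e2.
Proof.
apply/colP; case=> -[|[|//]] ? /=; rewrite !mxE big_ord_recr big_ord1 !mxE /=.
  by rewrite !mul0r mulr0 addr0.
by rewrite mulr0 addr0.
Qed.

Lemma mul_MQ_gen_g_h j k : MQ_gen_g beta t j *m h k = (t j)%:M.
Proof.
apply/matrixP=> i l; rewrite !ord1 !mxE big_ord_recr big_ord1 !mxE /=.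
by rewrite mulr1 mulr0 addr0.
Qed.

Lemma mul_MQ_gen_g_e2 j : MQ_gen_g beta t j *m e2 = (- beta j)%:M.
Proof.
apply/matrixP=> i l; rewrite !ord1 !mxE big_ord_recr big_ord1 !mxE /=.
by rewrite mulr1 mulr0 add0r.
Qed.

Lemma mul_prod_MQ_gen_b_e2 r :
  (\prod_(i <- r) b i) *m e2 = (\prod_(i <- r) alpha i) *: e2.
Proof.
elim: r => [|i r IHr]; first by rewrite !big_nil mul1mx scale1r.
rewrite !big_cons -mulmxE -mulmxA IHr -scalemxAr mul_MQ_gen_b_e2 scalerA.
by rewrite mulrC.
Qed.

(** The rightmost factor is the only one that meets [h], so it is split off;
    the others act on the line spanned by [e2]. *)
Lemma mul_prod_MQ_gen_b_h m k l : (m <= k)%N ->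
  (\prod_(m <= i < k.+1) b i) *m h l
  = ((\prod_(m <= i < k) alpha i) * gamma k) *: e2.
Proof.
move=> le_mk; rewrite big_nat_recr //= -mulmxE -mulmxA mul_MQ_gen_b_h.
by rewrite -scalemxAr mul_prod_MQ_gen_b_e2 scalerA mulrC.
Qed.

End Generators.

Theorem lemma3p2 (R : realType) (n : nat)
    (alpha beta gamma t : nat -> R[i]) :
  upper_2quasiseparable (MQ_tilde n alpha beta gamma t)
    (@MQ_gen_d R[i])
    (MQ_gen_g beta t)
    (MQ_gen_b alpha gamma)
    (@MQ_gen_h R[i]).
Proof.
move=> j k; rewrite mxE; case: ltnP => // le_jk; case: eqP => // /eqP neq_kj.
case: eqP => [_|/eqP neq_kSj]; first by rewrite mul_MQ_gen_g_h mxE.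
have lt_Sjk : (j.+2 <= k)%N by rewrite !ltn_neqAle eq_sym neq_kSj eq_sym neq_kj.
rewrite -mulmxA mul_prod_MQ_gen_b_h // -scalemxAr mul_MQ_gen_g_e2 !mxE.
by rewrite /MQ_entry /alpha_times mulr1n [RHS]mulrC mulrA.
Qed.
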